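(* Let $j\in\{0,\ldots,J-1\}$, let $\bar Y$ be a subsolution to the dynamic program $$Y_i=F_i(E_i[\beta_{i+1}Y_{i+1}]),\quad i=J-1,\ldots,0,\qquad Y_J=\xi,$$ whose solution is denoted by $Y$, and let $\bar M\in\mathcal M_D$ be the Doob martingale of $\beta\bar Y$. Further let $\bar r\in\mathcal A_0$ be an adapted process that solves $$\bar r_i^{\top}E_i[\beta_{i+1}\bar Y_{i+1}]-F_i^{\#}(\bar r_i)=F_i\left(E_i[\beta_{i+1}\bar Y_{i+1}]\right)\quad P\text{-a.s.}$$ for every $i=0,\ldots,J-1$. Then, for any $M\in\mathcal M_D$, the process $\theta^{low}(\bar r,M)$ satisfies $$Y_i\ \ge\ E_i\left[\theta_i^{low}(\bar r,M)\right]\ \ge\ F_i\left(E_i[\beta_{i+1}\bar Y_{i+1}]\right)\ \ge\ \bar Y_i\quad P\text{-a.s.}$$ for all $i=0,\ldots,J-1$. Moreover, if $\bar Y_i=Y_i$ for all $i=j+1,\ldots,J$, then $$E_j\left[\theta_j^{low}(\bar r,M)\right]=\theta_j^{low}(\bar r,\bar M)=Y_j\quad P\text{-a.s.}$$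
   Context: Setting. $(\Omega,\mathcal F,(\mathcal F_j)_{j=0,\ldots,J},P)$ is a complete filtered probability space in discrete time, and $E_j[\cdot]$ denotes conditional expectation given $\mathcal F_j$. For $m\in\mathbb N$, $L^{\infty-}(\mathbb R^m)$ is the set of $\mathbb R^m$-valued ($\mathcal F$-measurable) random variables that are in $L^p(\Omega,P)$ for all $p\ge1$; $L^{\infty-}_j(\mathbb R^m)$ is the subset of $\mathcal F_j$-measurable ones; $L^{\infty-}_{ad}(\mathbb R^m)$ is the set of adapted processes $Z$ with $Z_j\in L_j^{\infty-}(\mathbb R^m)$ for every $j=0,\ldots,J$. Standing assumptions on the data. (i) For $j=0,\ldots,J-1$, $F_j:\Omega\times\mathbb R^D\to\mathbb R$ is measurable, $F_j(\cdot,z)$ is $\mathcal F_j$-measurable for every $z\in\mathbb R^D$, and $z\mapsto F_j(\omega,z)$ is convex for every $\omega\in\Omega$. (ii) There are a constant $q\ge0$ and a nonnegative adapted process $\alpha$ with $\alpha_j\in L^p(\Omega,P)$ for all $p\ge1$ such that $|F_j(z)|\le\alpha_j(1+|z|^q)$ $P$-a.s. for every $z\in\mathbb R^D$ and $j=0,\ldots,J-1$. (iii) $\beta$ is an adapted $\mathbb R^D$-valued process in $L^p(\Omega,P)$ for all $p\ge1$, and $\xi$ is a real-valued $\mathcal F_J$-measurable random variable with $E[|\xi|^p]<\infty$ for all $p\ge1$. (iv) Monotonicity: for all $Y^{(1)},Y^{(2)}\in L^{\infty-}(\mathbb R)$ with $Y^{(1)}\ge Y^{(2)}$ $P$-a.s.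 and every $j=0,\ldots,J-1$, $F_j(\beta_{j+1}Y^{(1)})\ge F_j(\beta_{j+1}Y^{(2)})$ $P$-a.s. Under (i)–(iii) the dynamic program has a $P$-a.s. unique solution $Y\in L^{\infty-}_{ad}(\mathbb R)$. Definitions. A process $\bar Y\in L^{\infty-}_{ad}(\mathbb R)$ is a subsolution to the dynamic program if $\bar Y_J\le Y_J$ and $\bar Y_j\le F_j(E_j[\beta_{j+1}\bar Y_{j+1}])$ $P$-a.s. for every $j=0,\ldots,J-1$. $\mathcal M_D$ is the set of $\mathbb R^D$-valued martingales that are elements of $L^{\infty-}_{ad}(\mathbb R^D)$. The Doob martingale of a process $Z\in L^{\infty-}_{ad}(\mathbb R^D)$ is the process $\sum_{i=0}^{j-1}(Z_{i+1}-E_i[Z_{i+1}])$, $j=0,\ldots,J$; in particular the Doob martingale of $\beta\bar Y$ is $\sum_{i=0}^{j-1}(\beta_{i+1}\bar Y_{i+1}-E_i[\beta_{i+1}\bar Y_{i+1}])$. The convex conjugate is $F_j^{\#}(\omega,u)=\sup_{z\in\mathbb R^D}(u^\top z-F_j(\omega,z))\in(-\infty,+\infty]$. The set of admissible controls is $$\mathcal A_0=\{(r_i)_{i=0,\ldots,J-1}\mid r_i\in L_i^{\infty-}(\mathbb R^D),\ F_i^{\#}(r_i)\in L^{\infty-}(\mathbb R)\text{ for } i=0,\ldots,J-1\}.$$ For $r\in\mathcal A_0$ and $M\in\mathcal M_D$, the (typically non-adapted) process $\theta^{low}=\theta^{low}(r,M)$ is defined by the pathwise backward recursion $$\theta_J^{low}=\xi,\qquad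 \theta_j^{low}=r_j^\top\beta_{j+1}\theta_{j+1}^{low}-r_j^\top(M_{j+1}-M_j)-F_j^{\#}(r_j),\quad j=J-1,\ldots,0.$$ *)

(* Defs.v *)
From HB Require Import structures.
From mathcomp Require Import all_boot all_order all_algebra.
From mathcomp Require Import all_classical all_reals all_analysis.
From mathcomp Require Import measurable_realfun.

Set Implicit Arguments.
Unset Strict Implicit.
Unset Printing Implicit Defensive.

Import Order.TTheory GRing.Theory Num.Theory.
Import numFieldNormedType.Exports.

Local Open Scope classical_set_scope.
Local Open Scope ring_scope.

(* Matrices over R (in particular R^m = 'cV[R]_m) carry their Borel
   sigma-algebra. *)
HB.instance Definition _ (R : realType) (m n : nat) :=
  @isMeasurable.Build (sigma_display (@open 'M[R]_(m, n))) 'M[R]_(m, n)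
    <<s @open 'M[R]_(m, n) >> (@sigma_algebra0 _ setT open)
    (@sigma_algebraC _ open) (@sigma_algebra_bigcup _ setT open).

Section Vectors.
Context {R : realType} {m : nat}.
Implicit Types u v : 'cV[R]_m.

Definition dotv u v : R := (u^T *m v) 0 0.

(* The library norm on matrices is the sup norm, hence this definition. *)
Definition enorm u : R := Num.sqrt (dotv u u).

Definition conjugate (f : 'cV[R]_m -> R) u : \bar R :=
  ereal_sup (range (fun z => (dotv u z - f z)%:E)).

End Vectors.

Definition measurable_wrt {T : Type} {d} {U : measurableType d}
    (G : set (set T)) (X : T -> U) : Prop :=
  forall B : set U, measurable B -> G (X @^-1` B).

Section Probability.
Context {d : measure_display} {T : measurableType d} {R : realType}.
Variable P : probability T R.

(* L^{oo-}(R): the intersection of the L^p, 1 <= p < oo. *)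
Definition Linfm (X : T -> R) : Prop :=
  forall p : R, 1 <= p -> X \in Lfun P p%:E.

Definition Linfmv {m : nat} (X : T -> 'cV[R]_m) : Prop :=
  measurable_fun setT X /\ Linfm (enorm \o X).

(* Membership of an extended real-valued X in L^{oo-}(R): for p = 1 the bound
   forces X to be finite almost surely. *)
Definition Linfme (X : T -> \bar R) : Prop :=
  measurable_fun setT X /\
  forall p : R, 1 <= p -> ('N[P]_(p%:E)[X] < +oo)%E.

Definition is_condexp (G : set (set T)) (X Z : T -> R) : Prop :=
  [/\ measurable_wrt G Z,
      P.-integrable setT (EFin \o Z) &
      forall A, G A ->
        (\int[P]_(w in A) (Z w)%:E = \int[P]_(w in A) (X w)%:E)%E].

(* A version of E[X | G]; such a version exists whenever X is integrable and G
   is a sub-sigma-algebra. *)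
Definition condexp (G : set (set T)) (X : T -> R) : T -> R :=
  xget (fun=> 0) [set Z | is_condexp G X Z].

Definition condexpv {m : nat} (G : set (set T)) (X : T -> 'cV[R]_m) :
    T -> 'cV[R]_m :=
  fun w => \col_k condexp G (fun w' => X w' k 0) w.

End Probability.

(* Time-indexed objects are families over nat; only the indices j <= J
   (resp. j < J) are ever constrained or used. *)
Section Dynamic.
Context {d : measure_display} {T : measurableType d} {R : realType}.
Variables (P : probability T R) (J : nat) (Fil : nat -> set (set T)).

Definition complete_filtration : Prop :=
  [/\ forall j, (j <= J)%N -> sigma_algebra setT (Fil j),
      forall j, (j <= J)%N -> Fil j `<=` measurable,
      forall i j, (i <= j <= J)%N -> Fil i `<=` Fil j &
      P.-negligible `<=` Fil 0].

Definition Linfm_ad (Z : nat -> T -> R) : Prop :=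
  forall j, (j <= J)%N -> measurable_wrt (Fil j) (Z j) /\ Linfm P (Z j).

Definition Linfmv_ad {m : nat} (Z : nat -> T -> 'cV[R]_m) : Prop :=
  forall j, (j <= J)%N -> measurable_wrt (Fil j) (Z j) /\ Linfmv P (Z j).

Definition martingale {m : nat} (M : nat -> T -> 'cV[R]_m) : Prop :=
  Linfmv_ad M /\
  forall i k, (i <= k <= J)%N ->
    {ae P, forall w, condexpv P (Fil i) (M k) w = M i w}.

Definition doob {m : nat} (Z : nat -> T -> 'cV[R]_m) :
    nat -> T -> 'cV[R]_m :=
  fun j w => \sum_(0 <= i < j) (Z i.+1 w - condexpv P (Fil i) (Z i.+1) w).

Variable D : nat.
Implicit Types (F : nat -> T -> 'cV[R]_D -> R) (beta : nat -> T -> 'cV[R]_D).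
Implicit Types (r M : nat -> T -> 'cV[R]_D) (Y Ybar : nat -> T -> R).
Implicit Types (xi : T -> R).

Definition convex_generator F : Prop :=
  forall j, (j < J)%N ->
    [/\ measurable_fun setT (fun wz : T * 'cV[R]_D => F j wz.1 wz.2),
        forall z, measurable_wrt (Fil j) (fun w => F j w z) &
        forall w, convex_function
          (setT : set (convex_lmodType 'cV[R]_D)) (F j w)].

Definition polynomial_growth F : Prop :=
  exists (q : R) (alpha : nat -> T -> R),
    [/\ 0 <= q,
        Linfm_ad alpha,
        forall j, (j <= J)%N -> {ae P, forall w, 0 <= alpha j w} &
        forall j z, (j < J)%N ->
          {ae P, forall w, `|F j w z| <= alpha j w * (1 + enorm z `^ q)}].

Definition monotone_generator F beta : Prop :=
  forall Y1 Y2 : T -> R, Linfm P Y1 -> Linfm P Y2 ->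
    {ae P, forall w, Y2 w <= Y1 w} ->
    forall j, (j < J)%N ->
      {ae P, forall w,
        F j w (Y2 w *: beta j.+1 w) <= F j w (Y1 w *: beta j.+1 w)}.

Definition scaled beta Y : nat -> T -> 'cV[R]_D :=
  fun j w => Y j w *: beta j w.

(* E_j [beta_(j+1) Y_(j+1)] *)
Definition cond_next beta Y (j : nat) : T -> 'cV[R]_D :=
  condexpv P (Fil j) (scaled beta Y j.+1).

Definition dp_solution F beta xi Y : Prop :=
  [/\ Linfm_ad Y,
      {ae P, forall w, Y J w = xi w} &
      forall j, (j < J)%N ->
        {ae P, forall w, Y j w = F j w (cond_next beta Y j w)}].

Definition dp_subsolution F beta Y Ybar : Prop :=
  [/\ Linfm_ad Ybar,
      {ae P, forall w, Ybar J w <= Y J w} &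
      forall j, (j < J)%N ->
        {ae P, forall w, Ybar j w <= F j w (cond_next beta Ybar j w)}].

Definition admissible F r : Prop :=
  forall i, (i < J)%N ->
    [/\ measurable_wrt (Fil i) (r i),
        Linfmv P (r i) &
        Linfme P (fun w => conjugate (F i w) (r i w))].

(* theta_from k is theta^low at time J - k; for admissible r the conjugate is
   finite almost surely, so that fine only acts on a null set. *)
Fixpoint theta_from F beta xi r M (k : nat) (w : T) : R :=
  if k is k'.+1 then
    let j := (J - k)%N in
    dotv (r j w) (beta j.+1 w) * theta_from F beta xi r M k' w
    - dotv (r j w) (M j.+1 w - M j w)
    - fine (conjugate (F j w) (r j w))
  else xi w.

Definition theta_low F beta xi r M (j : nat) : T -> R :=
  theta_from F beta xi r M (J - j).

End Dynamic.

(* Main.v *)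
Require Import Defs.
From mathcomp Require Import all_boot all_order all_algebra.
From mathcomp Require Import all_classical all_reals all_analysis.
From mathcomp Require Import measurable_realfun.
From mathcomp Require Import ring lra.

(** Write W_i for the conditional expectation of theta_i given F_i, rho_i for
    the scalar weight r_i^T beta_(i+1), and c_i for the conjugate of F_i at
    r_i. The martingale increment in the recursion for theta has conditional
    mean zero, and c_i is known at time i, so the tower property turns the
    recursion into

      W_i = E_i[rho_i W_(i+1)] - c_i        ([condexp_theta_step]).

    Everything rests on the sign rho_i >= 0 ([monotone_weight_ge0]), extracted
    from the monotonicity of the generator: on the event rho_i < 0, evaluating
    F_i at the points - n rho_i^- beta_(i+1) gives values that monotonicity
    bounds by F_i(0), while the Fenchel inequality makes them at least
    n rho_i^2 - c_i for every n.

    Once rho_i >= 0, the displayed equation preserves comparisons, and backward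
    induction gives Ybar_i <= W_i <= Y_i. From W_(i+1) <= Y_(i+1) follows
    W_i <= r_i^T E_i[beta_(i+1) Y_(i+1)] - c_i, which the Fenchel inequality
    bounds by F_i(E_i[beta_(i+1) Y_(i+1)]) = Y_i ([condexp_theta_le]); from
    W_(i+1) >= Ybar_(i+1) follows W_i >= r_i^T E_i[beta_(i+1) Ybar_(i+1)] - c_i,
    which by the choice of r equals F_i(E_i[beta_(i+1) Ybar_(i+1)]) >= Ybar_i
    ([condexp_theta_ge]).

    If Ybar agrees with Y after time j, both ends of this chain at time j are
    Y_j. For the Doob martingale of beta Ybar, the noise
    rho_i theta_(i+1) - r_i^T (M_(i+1) - M_i) collapses pathwise to
    r_i^T E_i[beta_(i+1) Y_(i+1)], hence theta_i = Y_i for all i >= j by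
    backward induction.

    Conditional expectations are handled through the relation [is_condexp].
    Existence is the Radon-Nikodym theorem on the sub-sigma-algebra
    ([condexp_exists]); the pull-out rule ([is_condexpM]) is proved for
    unbounded factors, since r and beta are only in every L^p.
    Measurability of c_i with respect to F_i holds because the supremum that
    defines the conjugate of a finite convex function can be taken over
    rational points ([conjugate_rational]). *)

Set Implicit Arguments.
Unset Strict Implicit.
Unset Printing Implicit Defensive.

Import Order.TTheory GRing.Theory Num.Theory.
Import numFieldNormedType.Exports.

Local Open Scope classical_set_scope.
Local Open Scope ring_scope.

(** * Measurability and existence of conditional expectation for a sub-sigma-algebra *)

Section SubSigmaAlgebra.
Context {d : measure_display} {T : measurableType d} {R : realType}.
Variable P : probability T R.
Variable G : set (set T).
Hypothesis sG : sigma_algebra setT G.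
Hypothesis GT : G `<=` measurable.

Lemma g_sigma_measurableP (A : set T) :
  measurable (A : set (g_sigma_algebraType G)) <-> G A.
Proof. by rewrite measurable_g_measurableTypeE. Qed.

(** Turns measurability with respect to G into ordinary measurability on the
    copy of T that carries G, where the closure properties of measurable
    functions are available. *)
Lemma measurable_wrtP {d'} {U : measurableType d'} (X : T -> U) :
  measurable_wrt G X <->
  measurable_fun setT (X : g_sigma_algebraType G -> U).
Proof.
split=> [mX _ B mB|mX B mB].
  by rewrite setTI; apply: sub_gen_smallest; exact: mX.
have := mX measurableT B mB.
by rewrite setTI measurable_g_measurableTypeE.
Qed.

Lemma measurable_wrtW {d'} {U : measurableType d'} (X : T -> U) :
  measurable_wrt G X -> measurable_fun setT X.
Proof. by move=> mX _ B mB; rewrite setTI; apply/GT/mX. Qed.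

Lemma measurable_sub_sigma :
  measurable_fun setT (id : T -> g_sigma_algebraType G).
Proof. by apply: measurable_wrtW => B; rewrite /= measurable_g_measurableTypeE. Qed.

(** The charge A |-> E[X; A] restricted to G is absolutely continuous with
    respect to P restricted to G; both restrictions are push-forwards along the
    identity, and the density is the conditional expectation. *)
Lemma condexp_exists (X : T -> R) : P.-integrable setT (EFin \o X) ->
  exists Z, is_condexp P G X Z.
Proof.
move=> iX.
have mid := measurable_sub_sigma.
pose idG : {mfun T >-> g_sigma_algebraType G} := mfun_Sub (mem_set mid).
pose PG : probability (g_sigma_algebraType G) R := distribution P idG.
pose nuG : {charge set (g_sigma_algebraType G) -> \bar R} :=
  pushforward (induced_charge iX) (id : T -> g_sigma_algebraType G).
pose nu := nuG mid.
have numu : nu `<< PG.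
  apply/null_content_dominatesP => A mA PA0.
  have GA : G A by move: mA; rewrite /= measurable_g_measurableTypeE.
  have mA' : d.-measurable A := GT GA.
  apply: null_set_integral => //.
  by apply: measurable_funTS; exact: measurable_int iX.
pose f := Radon_Nikodym nu PG.
have fE : EFin \o (fine \o f) = f.
  by apply/funext => w /=; rewrite fineK// Radon_Nikodym_fin_num.
have If : PG.-integrable setT f by exact: Radon_Nikodym_integrable.
have mf : measurable_fun setT f by apply: measurable_int If.
have Pf : P.-integrable setT f.
  apply/integrableP; split.
    by apply: (measurableT_comp mf).
  move/integrableP: If => [_].
  by rewrite ge0_integral_pushforward//; apply: measurableT_comp.
exists (fine \o f); split.
- apply/measurable_wrtP; apply/measurable_EFinP; rewrite fE; exact: mf.
- by rewrite fE.
- move=> A GA.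
  have mA : measurable (A : set (g_sigma_algebraType G)).
    by rewrite measurable_g_measurableTypeE.
  rewrite -/(comp EFin (fine \o f)) fE.
  have nuA : nu A = (\int[P]_(w in A) (X w)%:E)%E by [].
  rewrite -nuA (Radon_Nikodym_integral numu mA) -/f.
  rewrite (integral_pushforward mid mf)//.
  by apply: integrableS Pf => //; exact: GT.
Qed.
End SubSigmaAlgebra.

(** * Exchanging integrands that agree on a sub-sigma-algebra *)

Section NonnegativeIntegrands.
Context {d : measure_display} {T : measurableType d} {R : realType}.
Variable P : probability T R.
Variable G : set (set T).
Hypothesis sG : sigma_algebra setT G.
Hypothesis GT : G `<=` measurable.

Import HBNNSimple.

(** Expresses the integral through the set function A |-> E[u; A] evaluated
    on G alone, which is all that is known about u in the next lemma. *)
Lemma ge0_integral_simple_mul (h : {nnsfun (g_sigma_algebraType G) >-> R})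
    (u : T -> R) :
  measurable_fun setT u -> (forall w, 0 <= u w) ->
  (\int[P]_w (h w * u w)%:E =
   \sum_(y \in range h) (y%:E * \int[P]_(w in h @^-1` [set y]) (u w)%:E))%E.
Proof.
move=> mu u0.
have mA y : G (h @^-1` [set y]).
  by apply: (proj1 (g_sigma_measurableP sG _)); exact: measurable_sfunP.
have mAT y : d.-measurable (h @^-1` [set y]) := GT (mA y).
have ge0 y w : 0 <= y * \1_(h @^-1` [set y]) w * u w.
  rewrite mulr_ge0//; have := nnfun_muleindic_ge0 h y w.
  by rewrite lee_fin.
transitivity (\int[P]_w (\sum_(y \in range h)
    (y * \1_(h @^-1` [set y]) w * u w)%:E))%E.
  apply: eq_integral => w _; rewrite fsumEFin//; congr EFin.
  by rewrite [in LHS](fimfunE h w) mulr_fsuml.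
rewrite ge0_integral_fsum//; last 2 first.
- move=> y; apply/measurable_EFinP; apply: measurable_funM => //.
  by apply: measurable_funM => //; exact: measurable_indic.
- by move=> y w _; rewrite lee_fin.
apply: eq_fsbigr => y /[!inE] -[w _ <-].
rewrite [in RHS]integral_mkcond epatch_indic.
rewrite -ge0_integralZl//; last 3 first.
- apply: emeasurable_funM => //; first exact/measurable_EFinP.
  by apply/measurable_EFinP; exact: measurable_indic.
- by move=> x _; rewrite mule_ge0// lee_fin.
- by rewrite lee_fin.
by apply: eq_integral => x _; rewrite /= -!EFinM mulrA mulrAC.
Qed.

(** Monotone approximation of f by G-measurable simple functions reduces the
    claim to integrals of u and v over sets of G. Both sides may be infinite,
    which is what later gives integrability of a product for free. *)
Lemma ge0_integral_mul_eq (f u v : T -> R) :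
  measurable_wrt G f -> (forall w, 0 <= f w) ->
  measurable_fun setT u -> (forall w, 0 <= u w) ->
  measurable_fun setT v -> (forall w, 0 <= v w) ->
  (forall A, G A -> \int[P]_(w in A) (u w)%:E = \int[P]_(w in A) (v w)%:E)%E ->
  (\int[P]_w (f w * u w)%:E = \int[P]_w (f w * v w)%:E)%E.
Proof.
move=> mf f0 mu u0 mv v0 uv.
have mfG : measurable_fun [set: g_sigma_algebraType G] (EFin \o f).
  by apply/measurable_EFinP; apply/measurable_wrtP.
pose h := nnsfun_approx measurableT mfG.
have lim_int (k : T -> R) : measurable_fun setT k -> (forall w, 0 <= k w) ->
    (\int[P]_w (f w * k w)%:E =
      limn (fun n => \int[P]_w (h n w * k w)%:E))%E.
  move=> mk k0.
  rewrite -monotone_convergence//; first last.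
  - move=> w _ a b ab; rewrite lee_fin ler_wpM2r//.
    by have /lefP := nd_nnsfun_approx measurableT mfG ab; apply.
  - by move=> n w _; rewrite lee_fin mulr_ge0.
  - move=> n; apply/measurable_EFinP; apply: measurable_funM => //.
    apply: (measurable_wrtW GT); apply/(measurable_wrtP sG).
    exact: measurable_funP.
  apply: eq_integral => w _; apply/esym/cvg_lim => //.
  under eq_fun do rewrite EFinM muleC.
  rewrite mulrC EFinM; apply: cvgeZl => //.
  by apply: cvg_nnsfun_approx => // x _; rewrite lee_fin.
rewrite !lim_int//; congr (limn _); apply/funext => n.
rewrite !ge0_integral_simple_mul//; apply: eq_fsbigr => y _.
by rewrite uv//; apply: (proj1 (g_sigma_measurableP sG _)); exact: measurable_sfunP.
Qed.
End NonnegativeIntegrands.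

(** * Order, linearity and tower property of conditional expectation *)

Section ConditionalExpectation.
Context {d : measure_display} {T : measurableType d} {R : realType}.
Variable P : probability T R.
Variable G : set (set T).
Hypothesis sG : sigma_algebra setT G.
Hypothesis GT : G `<=` measurable.

Lemma condexpP (X : T -> R) : P.-integrable setT (EFin \o X) ->
  is_condexp P G X (condexp P G X).
Proof. by move=> iX; apply: xgetPex; exact: condexp_exists. Qed.

(** A true equality of functions, since the chosen version depends only on the
    set of all versions. *)
Lemma condexp_ae_eq (X X' : T -> R) :
  measurable_fun setT X -> measurable_fun setT X' ->
  {ae P, forall w, X w = X' w} -> condexp P G X = condexp P G X'.
Proof.
move=> mX mX' XX'; rewrite /condexp; congr (xget _ _); apply/seteqP.
have eqA A : G A ->
    (\int[P]_(w in A) (X w)%:E = \int[P]_(w in A) (X' w)%:E)%E.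
  move=> GA; apply: ae_eq_integral => //; first exact: GT.
  - by apply/measurable_EFinP; exact: measurable_funTS.
  - by apply/measurable_EFinP; exact: measurable_funTS.
  - by apply: filterS XX' => w XX'w _; rewrite XX'w.
split=> Z [mZ iZ ZE]; split=> // A GA; first by rewrite -eqA// ZE.
by rewrite eqA// ZE.
Qed.

Lemma is_condexp_self (X : T -> R) :
  measurable_wrt G X -> P.-integrable setT (EFin \o X) -> is_condexp P G X X.
Proof. by []. Qed.

(** The event A = (Z > Z') lies in G, and the integral of Z - Z' over A equals
    that of X - X', hence is nonpositive; so Z - Z' > 0 forces A to be null. *)
Lemma is_condexp_le (X X' Z Z' : T -> R) :
  P.-integrable setT (EFin \o X) -> P.-integrable setT (EFin \o X') ->
  is_condexp P G X Z -> is_condexp P G X' Z' ->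
  {ae P, forall w, X w <= X' w} -> {ae P, forall w, Z w <= Z' w}.
Proof.
move=> iX iX' [mZ iZ ZE] [mZ' iZ' ZE'] XX'.
pose A := (Z \- Z') @^-1` `]0, +oo[.
have GA : G A.
  apply: (proj1 (g_sigma_measurableP sG _)); rewrite -[X in measurable X]setTI.
  apply: measurable_funB => //; exact/(measurable_wrtP sG).
have mA := GT GA.
have iA (f : T -> R) : P.-integrable setT (EFin \o f) ->
  P.-integrable A (EFin \o f) by exact: integrableS.
have le0 : (\int[P]_(w in A) `|(Z w - Z' w)%:E| <= 0)%E.
  have -> : (\int[P]_(w in A) `|(Z w - Z' w)%:E| =
             \int[P]_(w in A) (Z w - Z' w)%:E)%E.
    apply: eq_integral => w /[!inE]; rewrite /A /= in_itv/= andbT => Aw.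
    by rewrite ger0_norm// ltW.
  under eq_integral do rewrite EFinB.
  rewrite integralB//; [|exact: iA..].
  rewrite ZE// ZE'// -integralB//; [|exact: iA..].
  rewrite -oppe_ge0 -integralN/=; last first.
    exact/integrable_add_def/(integrableB mA (iA _ iX) (iA _ iX')).
  have -> : (\int[P]_(w in A) (- ((X w)%:E - (X' w)%:E)) =
             \int[P]_(w in A) `|(X w)%:E - (X' w)%:E|)%E.
    apply: ae_eq_integral => //.
    - by apply: measurable_int; apply: integrableN; apply: integrableB => //; exact: iA.
    - by apply: measurable_int; apply: integrable_abse; apply: integrableB => //; exact: iA.
    - apply: filterS XX' => w XX'w _.
      by rewrite -EFinB /=; congr EFin; rewrite ler0_norm// subr_le0.
  exact: integral_ge0.
have /ae_eq_integral_abs : (\int[P]_(w in A) `|(Z w - Z' w)%:E| = 0)%E.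
  by apply/eqP; rewrite eq_le le0 integral_ge0.
move=> /(_ mA) H.
have : ae_eq P A (fun w => (Z w - Z' w)%:E) (cst 0%E).
  apply: H; apply/measurable_EFinP; apply: measurable_funB; apply: measurable_funTS.
    exact: measurable_wrtW mZ.
  exact: measurable_wrtW mZ'.
apply: filterS => w Aw0; rewrite leNgt; apply/negP => ltw.
have /Aw0 [] : A w by rewrite /A /= in_itv/= andbT subr_gt0.
by apply/eqP; rewrite subr_eq0 gt_eqF.
Qed.

Lemma is_condexp_ae_eq (X Z Z' : T -> R) :
  P.-integrable setT (EFin \o X) ->
  is_condexp P G X Z -> is_condexp P G X Z' -> {ae P, forall w, Z w = Z' w}.
Proof.
move=> iX cZ cZ'.
have XX : {ae P, forall w, X w <= X w} by apply: aeW => w.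
apply: filterS2 (is_condexp_le iX iX cZ cZ' XX)
  (is_condexp_le iX iX cZ' cZ XX) => w ZZ' Z'Z.
by apply/eqP; rewrite eq_le ZZ'.
Qed.

Lemma is_condexp_version (X Z Z' : T -> R) :
  is_condexp P G X Z -> measurable_wrt G Z' ->
  {ae P, forall w, Z w = Z' w} -> is_condexp P G X Z'.
Proof.
move=> [mZ iZ ZE] mZ' ZZ'; split=> //.
- apply/integrableP; split.
    by apply/measurable_EFinP; exact: measurable_wrtW mZ'.
  move/integrableP: iZ => [mZT]; congr (_ < _)%E; apply: ae_eq_integral => //.
  + exact: measurableT_comp.
  + by apply: measurableT_comp => //; apply/measurable_EFinP; exact: measurable_wrtW mZ'.
  + by apply: filterS ZZ' => w /= ->.
- move=> A GA; rewrite -ZE//; apply: ae_eq_integral.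
  + exact: GT.
  + by apply/measurable_EFinP; apply: measurable_funTS; exact: measurable_wrtW mZ'.
  + by apply/measurable_EFinP; apply: measurable_funTS; exact: measurable_wrtW mZ.
  + by apply: filterS ZZ' => w /= ->.
Qed.

Lemma is_condexpD (X X' Z Z' : T -> R) :
  P.-integrable setT (EFin \o X) -> P.-integrable setT (EFin \o X') ->
  is_condexp P G X Z -> is_condexp P G X' Z' ->
  is_condexp P G (X \+ X') (Z \+ Z').
Proof.
move=> iX iX' [mZ iZ ZE] [mZ' iZ' ZE'].
have iA A (f : T -> R) : G A -> P.-integrable setT (EFin \o f) ->
  P.-integrable A (EFin \o f) by move=> GA; apply: integrableS => //; exact: GT.
split.
- apply/(measurable_wrtP sG); apply: measurable_funD; exact/(measurable_wrtP sG).
- have -> : EFin \o (Z \+ Z') = ((EFin \o Z) \+ (EFin \o Z'))%E by [].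
  exact: integrableD.
- move=> A GA; have mA := GT GA.
  under eq_integral do rewrite EFinD.
  under [in RHS]eq_integral do rewrite EFinD.
  rewrite (integralD mA (iA _ _ GA iZ) (iA _ _ GA iZ')).
  by rewrite (integralD mA (iA _ _ GA iX) (iA _ _ GA iX')) ZE// ZE'.
Qed.

Lemma is_condexpN (X Z : T -> R) :
  P.-integrable setT (EFin \o X) ->
  is_condexp P G X Z -> is_condexp P G (\- X) (\- Z).
Proof.
move=> iX [mZ iZ ZE].
have iA A (f : T -> R) : G A -> P.-integrable setT (EFin \o f) ->
  P.-integrable A (EFin \o f) by move=> GA; apply: integrableS => //; exact: GT.
split.
- apply/(measurable_wrtP sG); apply: measurable_funN; exact/(measurable_wrtP sG).
- by have := integrableN iZ.
- move=> A GA; have mA := GT GA.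
  have EN (f : T -> R) : P.-integrable setT (EFin \o f) ->
      (\int[P]_(w in A) ((\- f) w)%:E = - \int[P]_(w in A) (f w)%:E)%E.
    by move=> f_int; rewrite -integralN//; exact/integrable_add_def/iA.
  by rewrite !EN// ZE.
Qed.

Lemma is_condexp_tower (H : set (set T)) (X W Z : T -> R) :
  G `<=` H -> is_condexp P H X W -> is_condexp P G X Z -> is_condexp P G W Z.
Proof.
by move=> GH [_ _ WE] [mZ iZ ZE]; split=> // A GA; rewrite ZE// WE//; exact: GH.
Qed.

End ConditionalExpectation.

(** * The pull-out rule *)

Section PullOut.
Context {d : measure_display} {T : measurableType d} {R : realType}.
Variable P : probability T R.
Variable G : set (set T).
Hypothesis sG : sigma_algebra setT G.
Hypothesis GT : G `<=` measurable.

Lemma measurable_wrt_cst (c : R) : measurable_wrt G (fun _ : T => c).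
Proof. by apply/(measurable_wrtP sG); exact: measurable_cst. Qed.

Lemma is_condexp0 : is_condexp P G (fun=> 0 : R) (fun=> 0).
Proof.
apply: is_condexp_self; first exact: measurable_wrt_cst.
by apply: integrable0.
Qed.

(** The pointwise sign, and not only the almost sure one, is what
    [ge0_integral_mul_eq] asks for. *)
Lemma ge0_condexp_exists (X : T -> R) :
  (forall w, 0 <= X w) -> P.-integrable setT (EFin \o X) ->
  exists2 Z, (forall w, 0 <= Z w) & is_condexp P G X Z.
Proof.
move=> X0 iX; have cX := condexpP sG GT iX.
exists (fun w => `|condexp P G X w|) => //.
apply: (is_condexp_version GT cX).
  apply/(measurable_wrtP sG); apply: measurableT_comp => //.
  by apply/(measurable_wrtP sG); case: cX.
have := is_condexp_le sG GT (integrable0 _ _) iX is_condexp0 cX.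
move=> /(_ (aeW _ X0)).
by apply: filterS => w Z0; rewrite ger0_norm.
Qed.

(** Nonnegative X and Z can be exchanged under any nonnegative G-measurable
    weight; the weights |r| and the two signed parts of r 1_A give integrability
    and the defining identity. *)
Lemma is_condexpM_ge0 (r X Z : T -> R) :
  measurable_wrt G r -> (forall w, 0 <= X w) -> (forall w, 0 <= Z w) ->
  P.-integrable setT (EFin \o X) ->
  P.-integrable setT (EFin \o (r \* X)) ->
  is_condexp P G X Z -> is_condexp P G (r \* X) (r \* Z).
Proof.
move=> mr X0 Z0 iX irX [mZ iZ ZE].
have mX : measurable_fun setT X by apply/measurable_EFinP; exact: measurable_int iX.
have mZT := measurable_wrtW GT mZ.
have swap (s : T -> R) : measurable_wrt G s -> (forall w, 0 <= s w) ->
    (\int[P]_w (s w * Z w)%:E = \int[P]_w (s w * X w)%:E)%E.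
  by move=> ms s0; exact: (ge0_integral_mul_eq sG GT).
have mrZ : measurable_wrt G (r \* Z).
  by apply/(measurable_wrtP sG); apply: measurable_funM; exact/(measurable_wrtP sG).
split=> //.
- apply/integrableP; split.
    by apply/measurable_EFinP; exact: measurable_wrtW mrZ.
  move/integrableP : irX => [_].
  have normE (V : T -> R) : (forall w, 0 <= V w) ->
      (\int[P]_w `|(EFin \o (r \* V)%R) w| = \int[P]_w (`|r w| * V w)%:E)%E.
    move=> V0; apply: eq_integral => w _ /=.
    by rewrite normrM (ger0_norm (V0 w)).
  rewrite !normE// swap//.
  by apply/(measurable_wrtP sG); apply: measurableT_comp => //; exact/(measurable_wrtP sG).
- move=> A GA; have mA := GT GA.
  (* Absorbing the indicator of A into the weight reduces to integrals over T. *)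
  pose s := (\1_A \* r : T -> R).
  have ms : measurable_wrt G s.
    apply/(measurable_wrtP sG); apply: measurable_funM; last exact/(measurable_wrtP sG).
    by apply: measurable_indic; exact/g_sigma_measurableP.
  have patchE (V : T -> R) : (forall w, 0 <= V w) ->
    (\int[P]_(w in A) (r w * V w)%:E =
      \int[P]_w (Num.max (s w) 0 * V w)%:E
      - \int[P]_w (Num.max (- s w) 0 * V w)%:E)%E.
    move=> V0; rewrite integral_mkcond integralE.
    congr (_ - _)%E; apply: eq_integral => w _.
    + rewrite funeposE epatch_indic /= -EFinM -EFin_max maxr_pMl//.
      by rewrite mul0r /s /= mulrC mulrA.
    + rewrite funenegE epatch_indic /= -EFin_max maxr_pMl//.
      by rewrite mul0r /s /= mulNr mulrC mulrA.
  rewrite !patchE// !swap//.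
  + apply/(measurable_wrtP sG); apply: measurable_maxr => //.
    by apply: measurable_funN; exact/(measurable_wrtP sG).
  + by move=> w; rewrite le_max lexx orbT.
  + apply/(measurable_wrtP sG); apply: measurable_maxr => //.
    exact/(measurable_wrtP sG).
  + by move=> w; rewrite le_max lexx orbT.
Qed.

(** Linearity in X reduces to the nonnegative case; the integrability of r Z,
    contained in the conclusion, is inherited from that case as well. *)
Lemma is_condexpM (r X Z : T -> R) :
  measurable_wrt G r ->
  P.-integrable setT (EFin \o X) ->
  P.-integrable setT (EFin \o (r \* X)) ->
  is_condexp P G X Z -> is_condexp P G (r \* X) (r \* Z).
Proof.
move=> mr iX irX cZ.
have mX : measurable_fun setT X by apply/measurable_EFinP; exact: measurable_int iX.
have mrT := measurable_wrtW GT mr.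
pose Xp w := Num.max (X w) 0; pose Xn w := Num.max (- X w) 0.
have Xp0 w : 0 <= Xp w by rewrite /Xp le_max lexx orbT.
have Xn0 w : 0 <= Xn w by rewrite /Xn le_max lexx orbT.
have XE w : X w = Xp w - Xn w.
  by rewrite /Xp /Xn; case: (leP (X w) 0) => X0; rewrite ?oppr_ge0 ?X0;
   case: leP; lra.
have Xple w : `|Xp w| <= `|X w|.
  rewrite /Xp ger0_norm ?le_max ?lexx ?orbT// ge_max normr_ge0 andbT.
  exact: ler_norm.
have Xnle w : `|Xn w| <= `|X w|.
  rewrite /Xn ger0_norm ?le_max ?lexx ?orbT// ge_max normr_ge0 andbT.
  by rewrite -normrN ler_norm.
have mXp : measurable_fun setT Xp by exact: measurable_maxr.
have mXn : measurable_fun setT Xn by apply: measurable_maxr => //; exact: measurable_funN.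
have dom (V : T -> R) : measurable_fun setT V -> (forall w, `|V w| <= `|X w|) ->
    P.-integrable setT (EFin \o V) /\ P.-integrable setT (EFin \o (r \* V)).
  move=> mV Vle; split.
    apply: le_integrable iX => //; first exact/measurable_EFinP.
    by move=> w _; rewrite lee_fin.
  apply: le_integrable irX => //.
    by apply/measurable_EFinP; exact: measurable_funM.
  by move=> w _; rewrite lee_fin /= !normrM ler_wpM2l.
have [iXp irXp] := dom _ mXp Xple.
have [iXn irXn] := dom _ mXn Xnle.
have [Zp Zp0 cZp] := ge0_condexp_exists Xp0 iXp.
have [Zn Zn0 cZn] := ge0_condexp_exists Xn0 iXn.
have crp := is_condexpM_ge0 mr Xp0 Zp0 iXp irXp cZp.
have crn := is_condexpM_ge0 mr Xn0 Zn0 iXn irXn cZn.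
have iNXn := integrableN iXn; have iNrXn := integrableN irXn.
have := is_condexpD sG GT iXp iNXn cZp (is_condexpN sG GT iXn cZn).
have -> : Xp \+ \- Xn = X by apply/funext => w; rewrite /= XE.
move=> cX.
have := is_condexpD sG GT irXp iNrXn crp (is_condexpN sG GT irXn crn).
have -> : (r \* Xp) \+ \- (r \* Xn) = r \* X.
  by apply/funext => w; rewrite /= XE mulrBr.
move=> crX; apply: (is_condexp_version GT crX).
  case: cZ => mZ _ _.
  by apply/(measurable_wrtP sG); apply: measurable_funM; exact/(measurable_wrtP sG).
apply: filterS (is_condexp_ae_eq sG GT iX cX cZ) => w /= <-.
by rewrite mulrBr.
Qed.

Lemma is_condexp_sum n (X Z : 'I_n -> T -> R) :
  (forall k, P.-integrable setT (EFin \o X k)) ->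
  (forall k, is_condexp P G (X k) (Z k)) ->
  is_condexp P G (fun w => \sum_k X k w) (fun w => \sum_k Z k w).
Proof.
move=> iX cX.
suff [] : P.-integrable setT (EFin \o (fun w => \sum_k X k w)) /\
   is_condexp P G (fun w => \sum_k X k w) (fun w => \sum_k Z k w) by [].
elim: n X Z iX cX => [|n IH] X Z iX cX.
  have -> : (fun w => \sum_k X k w) = cst 0 by apply/funext => w; rewrite big_ord0.
  have -> : (fun w => \sum_k Z k w) = cst 0 by apply/funext => w; rewrite big_ord0.
  split; last exact: is_condexp0.
  exact: integrable0.
have -> : (fun w => \sum_k X k w) = X ord0 \+ (fun w => \sum_k X (lift ord0 k) w).
  by apply/funext => w; rewrite big_ord_recl.
have -> : (fun w => \sum_k Z k w) = Z ord0 \+ (fun w => \sum_k Z (lift ord0 k) w).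
  by apply/funext => w; rewrite big_ord_recl.
have [i1 c1] := IH _ _ (fun k => iX (lift ord0 k)) (fun k => cX (lift ord0 k)).
split; last exact: is_condexpD.
exact: (integrableD measurableT (iX ord0) i1).
Qed.
End PullOut.

(** * Coordinates of vectors *)

Section Vectors.
Context {R : realType} {m : nat}.
Implicit Types u v : 'cV[R]_m.

Lemma dotvE u v : dotv u v = \sum_k u k 0 * v k 0.
Proof. by rewrite /dotv mxE; apply: eq_bigr => k _; rewrite mxE. Qed.

Lemma dotvZr u v (a : R) : dotv u (a *: v) = a * dotv u v.
Proof. by rewrite /dotv -scalemxAr mxE. Qed.

Lemma dotvDr u v w : dotv u (v + w) = dotv u v + dotv u w.
Proof. by rewrite /dotv mulmxDr mxE. Qed.

Lemma dotvBr u v w : dotv u (v - w) = dotv u v - dotv u w.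
Proof. by rewrite dotvDr -scaleN1r dotvZr mulN1r. Qed.

Lemma coord_le_enorm v k : `|v k 0| <= enorm v.
Proof.
rewrite -sqrtr_sqr ler_wsqrtr// dotvE (bigD1 k)//= expr2 lerDl.
by apply: sumr_ge0 => i _; rewrite -expr2 sqr_ge0.
Qed.

Lemma measurable_coord k :
  measurable_fun setT (fun v : 'cV[R]_m => v k 0).
Proof.
apply: (measurability _ (RGenOInfty.measurableE R)).
move=> _ [_ [x ->] <-]; rewrite setTI.
apply: sub_gen_smallest; apply: open_comp; last exact: interval_open.
by move=> v _; exact: coord_continuous.
Qed.
End Vectors.

(** * Random variables with finite moments of all orders *)

Section Moments.
Context {d : measure_display} {T : measurableType d} {R : realType}.
Variable P : probability T R.
Implicit Types X Y : T -> R.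

Lemma Linfm_measurable X : Linfm P X -> measurable_fun setT X.
Proof.
by move=> /(_ 1 (lexx _)); rewrite inE => /andP[/[!inE]].
Qed.

Lemma Linfm_integrable X : Linfm P X -> P.-integrable setT (EFin \o X).
Proof. by move=> /(_ 1 (lexx _)) /Lfun1_integrable. Qed.

(** The dominating function is extended real-valued in order to cover the
    conjugates, which may be infinite on a null set. *)
Lemma Linfme_dominated (X : T -> R) (Y : T -> \bar R) :
  measurable_fun setT X -> Linfme P Y ->
  (forall w, (`|X w|%:E <= `|Y w|)%E) -> Linfm P X.
Proof.
move=> mX [mY fY] XY p p1; rewrite inE; apply/andP; split; rewrite inE//=.
apply: le_lt_trans (fY p p1); rewrite unlock.
have mpow (f : T -> \bar R) : measurable_fun setT f ->
    measurable_fun setT (fun w => `|f w| `^ p)%E.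
  move=> mf; apply: (measurableT_comp (measurable_poweR p)).
  exact: measurableT_comp.
have p0 : 0 <= p by rewrite (le_trans _ p1).
apply: gt0_ler_poweR; first by rewrite invr_ge0.
- by rewrite in_itv/= leey andbT integral_ge0// => w _; exact: poweR_ge0.
- by rewrite in_itv/= leey andbT integral_ge0// => w _; exact: poweR_ge0.
apply: ge0_le_integral => //.
- by move=> w _; exact: poweR_ge0.
- by apply: mpow; exact/measurable_EFinP.
- exact: mpow.
- move=> w _; apply: gt0_ler_poweR => //.
  + by rewrite in_itv/= leey andbT.
  + by rewrite in_itv/= leey andbT abse_ge0.
  + exact: XY.
Qed.

Lemma Linfm_Linfme X : Linfm P X -> Linfme P (EFin \o X).
Proof.
move=> LX; split; first exact/measurable_EFinP/Linfm_measurable.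
by move=> p /LX; rewrite inE => /andP[_]; rewrite inE.
Qed.

Lemma Linfm_dominated X Y : measurable_fun setT X -> Linfm P Y ->
  (forall w, `|X w| <= `|Y w|) -> Linfm P X.
Proof.
by move=> mX /Linfm_Linfme LY XY; apply: Linfme_dominated LY _ => // w; rewrite lee_fin.
Qed.

Lemma Linfm_fine (Y : T -> \bar R) : Linfme P Y -> Linfm P (fine \o Y).
Proof.
move=> LY; apply: (Linfme_dominated _ LY).
  case: LY => mY _; apply: measurableT_comp mY.
  exact: (fine_measurable measurableT).
by move=> w /=; case: (Y w) => //=; rewrite normr0 leey.
Qed.

Lemma Linfm_cst c : Linfm P (cst c).
Proof. by move=> p _; exact: Lfun_cst. Qed.

Lemma LinfmD X Y : Linfm P X -> Linfm P Y -> Linfm P (X \+ Y).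
Proof.
move=> LX LY p p1; have p1' : (1 <= p%:E)%E by rewrite lee_fin.
by apply: (proj2 (Lfun_addr_closed P p1')); [exact: LX|exact: LY].
Qed.

Lemma LinfmN X : Linfm P X -> Linfm P (\- X).
Proof.
move=> LX; apply: (Linfm_dominated _ LX); last by move=> w /=; rewrite normrN.
by apply: measurable_funN; exact: Linfm_measurable.
Qed.

Lemma Linfm_sqr X : Linfm P X -> Linfm P (fun w => X w ^+ 2).
Proof.
move=> LX p p1; rewrite inE.
have mX := Linfm_measurable LX.
have p20 : 0 < p * 2 by rewrite mulr_gt0// (lt_le_trans _ p1).
apply/andP; split; rewrite inE/=; first exact: measurable_funX.
rewrite /finite_norm unlock poweR_lty//.
have p2 : 1 <= p * 2 by rewrite (le_trans p1)// ler_peMr ?(le_trans _ p1)// ler1n.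
have := LX _ p2; rewrite inE => /andP[_]; rewrite inE /= /finite_norm unlock.
move=> /lty_poweRy; rewrite invr_eq0 gt_eqF// => /(_ isT).
congr (_ < _)%E; apply: eq_integral => w _ /=; congr EFin.
by rewrite normrX mulrC powRrM powR_mulrn.
Qed.

(** By domination, since |X Y| <= X^2 + Y^2. *)
Lemma LinfmM X Y : Linfm P X -> Linfm P Y -> Linfm P (X \* Y).
Proof.
move=> LX LY.
have mX := Linfm_measurable LX; have mY := Linfm_measurable LY.
apply: (Linfm_dominated _ (LinfmD (Linfm_sqr LX) (Linfm_sqr LY))).
  exact: measurable_funM.
move=> w /=; rewrite [leRHS]ger0_norm ?addr_ge0 ?sqr_ge0// normrM.
rewrite -[X w ^+ 2]real_normK ?num_real// -[Y w ^+ 2]real_normK ?num_real//.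
have := sqr_ge0 (`|X w| - `|Y w|); rewrite sqrrB.
have := sqr_ge0 `|X w|; have := sqr_ge0 `|Y w|; rewrite !expr2; lra.
Qed.

Lemma LinfmB X Y : Linfm P X -> Linfm P Y -> Linfm P (X \- Y).
Proof. by move=> LX LY; exact: (LinfmD LX (LinfmN LY)). Qed.

Lemma Linfm_sum n (X : 'I_n -> T -> R) :
  (forall k, Linfm P (X k)) -> Linfm P (fun w => \sum_k X k w).
Proof.
elim: n X => [|n IH] X LX.
  have -> : (fun w => \sum_k X k w) = cst 0 by apply/funext => w; rewrite big_ord0.
  exact: Linfm_cst.
have -> : (fun w => \sum_k X k w) = X ord0 \+ (fun w => \sum_k X (lift ord0 k) w).
  by apply/funext => w; rewrite big_ord_recl.
by apply: LinfmD => //; exact: IH.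
Qed.

Lemma Linfmv_coord m (V : T -> 'cV[R]_m) k :
  Linfmv P V -> Linfm P (fun w => V w k 0).
Proof.
move=> [mV LV]; apply: (Linfm_dominated _ LV).
  exact: (measurableT_comp (measurable_coord k)).
by move=> w /=; rewrite (le_trans (coord_le_enorm _ k))// ler_norm.
Qed.

Lemma Linfm_dotv m (U V : T -> 'cV[R]_m) :
  (forall k, Linfm P (fun w => U w k 0)) ->
  (forall k, Linfm P (fun w => V w k 0)) ->
  Linfm P (fun w => dotv (U w) (V w)).
Proof.
move=> LU LV; under eq_fun do rewrite dotvE.
by apply: Linfm_sum => k; exact: LinfmM.
Qed.

End Moments.

(** * Convex conjugates as countable suprema *)

Section Conjugate.
Context {R : realType} {m : nat}.
Implicit Types (f : 'cV[R]_m -> R) (u z : 'cV[R]_m).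

Definition ratv (q : 'cV[rat]_m) : 'cV[R]_m := map_mx ratr q.

Lemma convex_function_le f (t : R) (x y : 'cV[R]_m) :
  convex_function (setT : set (convex_lmodType 'cV[R]_m)) f ->
  0 <= t -> t <= 1 ->
  f (t *: x + (1 - t) *: y) <= t * f x + (1 - t) * f y.
Proof.
move=> cf t0 t1.
by have := cf (Itv01 t0 t1) x y; rewrite !inE; apply.
Qed.

(** The coordinates of z are made rational one at a time. Moving from z' towards
    z' + e_k by a small fraction t of the way changes only the coordinate k,
    and convexity along that segment bounds the increase of f by
    t (f (z' + e_k) - f z'). *)
Lemma convex_rational_approx f z (e : R) :
  convex_function (setT : set (convex_lmodType 'cV[R]_m)) f -> 0 < e ->
  exists q, f (ratv q) < f z + e.
Proof.
move=> cf e0.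
have step n e' : (n <= m)%N -> 0 < e' -> exists z', f z' < f z + e' /\
    forall k : 'I_m, (k < n)%N -> exists q : rat, z' k 0 = ratr q.
  elim: n e' => [|n IH] e' nm e'0; first by exists z; split; rewrite // ltrDl.
  have [z' [fz' z'Q]] := IH _ (ltnW nm) (divr_gt0 e'0 (ltr0Sn _ 1)).
  pose k : 'I_m := Ordinal nm; pose b := z' + delta_mx k 0.
  (* The summand 1 makes C positive, so that e' / 2 / C is a legitimate step size. *)
  pose C := `|f b - f z'| + 1.
  have C0 : 0 < C by rewrite ltr_wpDl.
  have := @rat_in_itvoo R (z' k 0) (z' k 0 + Num.min 1 (e' / 2 / C)).
  rewrite ltrDl lt_min ltr01 !divr_gt0// => /(_ isT) [q].
  rewrite in_itv/= -ltrBlDl lt_min => /andP[zq /andP[q1 qC]].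
  pose t := ratr q - z' k 0.
  have t0 : 0 < t by rewrite subr_gt0.
  exists (t *: b + (1 - t) *: z'); split.
    apply: le_lt_trans (convex_function_le _ _ cf (ltW t0) (ltW q1)) _.
    have -> : t * f b + (1 - t) * f z' = f z' + t * (f b - f z') by ring.
    have : t * (f b - f z') <= t * C.
      by rewrite ler_pM2l// (le_trans (ler_norm _))// lerDl.
    have : t * C < e' / 2 by rewrite -ltr_pdivlMr.
    lra.
  have zE i : (t *: b + (1 - t) *: z') i 0 = z' i 0 + t * (i == k)%:R.
    by rewrite !mxE eqxx andbT; ring.
  move=> i; rewrite ltnS leq_eqVlt => /predU1P[ik|ik].
    exists q; rewrite zE; have -> : i = k by exact: val_inj.
    by rewrite eqxx mulr1 /t addrC subrK.
  have [q' z'i] := z'Q _ ik; exists q'; rewrite zE z'i.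
  by rewrite -val_eqE /= ltn_eqF// mulr0 addr0.
have [z' [fz' z'Q]] := step m e (leqnn m) e0.
have {}z'Q k := z'Q k (ltn_ord k).
exists (\col_k sval (cid (z'Q k))).
suff -> : ratv (\col_k sval (cid (z'Q k))) = z' by [].
by apply/colP => k; rewrite !mxE; case: cid.
Qed.

(** Indices that decode to no vector are sent to 0, so that the range is
    exactly the set of rational vectors. *)
Definition rat_enum (n : nat) : 'cV[rat]_m := odflt 0 (choice.unpickle n).

(** For fixed u the function z |-> f z - u^T z is again convex, so its infimum
    can be approached along rational points. *)
Lemma conjugate_rational f u :
  convex_function (setT : set (convex_lmodType 'cV[R]_m)) f ->
  conjugate f u =
  ereal_sup (range (fun n => (dotv u (ratv (rat_enum n)) - f (ratv (rat_enum n)))%:E)).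
Proof.
move=> cf; apply/eqP; rewrite eq_le; apply/andP; split; last first.
  apply: le_ereal_sup => _ [n _ <-].
  by exists (ratv (rat_enum n)).
apply: ge_ereal_sup => _ [z _ <-].
apply/lee_addgt0Pr => e e0.
pose g z := f z - dotv u z.
have cg : convex_function (setT : set (convex_lmodType 'cV[R]_m)) g.
  move=> t x y xT yT.
  have fle : f (conv t (x : convex_lmodType _) y) <=
      t%:num * f x + (1 - t%:num) * f y := cf t x y xT yT.
  have dE : dotv u (conv t (x : convex_lmodType _) y) =
      t%:num * dotv u x + (1 - t%:num) * dotv u y by rewrite -!dotvZr -dotvDr.
  suff : g (conv t (x : convex_lmodType _) y) <=
      t%:num * g x + (1 - t%:num) * g y by [].
  rewrite /g dE; lra.
have [q gq] := convex_rational_approx z cg e0.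
have {}gq : dotv u z - f z < dotv u (ratv q) - f (ratv q) + e by move: gq; rewrite /g; lra.
apply: (@le_trans _ _ ((dotv u (ratv q) - f (ratv q))%:E + e%:E)%E).
  by rewrite -EFinD lee_fin ltW.
rewrite leeD2r//; apply: ereal_sup_ubound; exists (pickle q) => //.
by rewrite /rat_enum pickleK.
Qed.

Lemma le_fine_conjugate f u z : conjugate f u \is a fin_num ->
  dotv u z - f z <= fine (conjugate f u).
Proof.
by move=> cfin; rewrite -lee_fin fineK//; apply: ereal_sup_ubound; exists z.
Qed.

End Conjugate.

Section ConjugateMeasurable.
Context {d : measure_display} {T : measurableType d} {R : realType} {m : nat}.
Variable G : set (set T).
Hypothesis sG : sigma_algebra setT G.

Lemma measurable_wrt_coord (V : T -> 'cV[R]_m) k :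
  measurable_wrt G V -> measurable_wrt G (fun w => V w k 0).
Proof.
move=> mV B mB; have := mV ((fun v : 'cV[R]_m => v k 0) @^-1` B); apply.
by rewrite -[X in measurable X]setTI; exact: measurable_coord.
Qed.

Lemma measurable_wrt_dotv (U V : T -> 'cV[R]_m) :
  measurable_wrt G U -> measurable_wrt G V ->
  measurable_wrt G (fun w => dotv (U w) (V w)).
Proof.
move=> mU mV; apply/(measurable_wrtP sG).
under eq_fun do rewrite dotvE.
apply: measurable_sum => k; apply: measurable_funM;
  exact/(measurable_wrtP sG)/measurable_wrt_coord.
Qed.

(** The supremum over rational points involves countably many functions, each
    of them G-measurable. *)
Lemma measurable_wrt_conjugate (F : T -> 'cV[R]_m -> R) (r : T -> 'cV[R]_m) :
  (forall z, measurable_wrt G (fun w => F w z)) ->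
  (forall w, convex_function (setT : set (convex_lmodType 'cV[R]_m)) (F w)) ->
  measurable_wrt G r ->
  measurable_wrt G (fun w => fine (conjugate (F w) (r w))).
Proof.
move=> mF cF mr; apply/(measurable_wrtP sG).
apply: (measurableT_comp (fine_measurable measurableT)).
pose u n (w : T) :=
  (dotv (r w) (ratv (rat_enum n)) - F w (ratv (rat_enum n)) : R)%:E.
rewrite [X in measurable_fun _ X](_ : _ = fun w => esups (u ^~ w) 0%N); last first.
  apply/funext => w; rewrite conjugate_rational// /esups; congr ereal_sup.
  by apply/seteqP; split=> x [n _ <-]; exists n.
apply: measurable_fun_esups => n; apply/measurable_EFinP.
apply: measurable_funB; apply/(measurable_wrtP sG) => //.
apply: measurable_wrt_dotv => //.
by apply/(measurable_wrtP sG); exact: measurable_cst.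
Qed.
End ConjugateMeasurable.

(** * Conditional means of one period *)

Section OnePeriod.
Context {d : measure_display} {T : measurableType d} {R : realType} {m : nat}.
Variable P : probability T R.
Variable G : set (set T).
Hypothesis sG : sigma_algebra setT G.
Hypothesis GT : G `<=` measurable.
Variable r : T -> 'cV[R]_m.
Hypothesis mr : measurable_wrt G r.
Hypothesis Lr : Linfmv P r.

Lemma is_condexp_dotv (V : T -> 'cV[R]_m) :
  (forall k, Linfm P (fun w => V w k 0)) ->
  is_condexp P G (fun w => dotv (r w) (V w))
                 (fun w => dotv (r w) (condexpv P G V w)).
Proof.
move=> LV.
have -> : (fun w => dotv (r w) (V w)) = fun w => \sum_k r w k 0 * V w k 0.
  by apply/funext => w; rewrite dotvE.
have -> : (fun w => dotv (r w) (condexpv P G V w)) =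
    fun w => \sum_k r w k 0 * condexp P G (fun w' => V w' k 0) w.
  by apply/funext => w; rewrite dotvE; apply: eq_bigr => k _; rewrite mxE.
have LrV k : Linfm P (fun w => r w k 0 * V w k 0).
  by apply: LinfmM => //; exact: Linfmv_coord.
apply: is_condexp_sum => // k; first exact: Linfm_integrable.
apply: is_condexpM => //.
- exact: measurable_wrt_coord.
- exact: (Linfm_integrable (LV k)).
- exact: (Linfm_integrable (LrV k)).
- exact: (condexpP sG GT (Linfm_integrable (LV k))).
Qed.

(** The coordinates of r are pulled out of the conditional expectation of the
    martingale increment, which vanishes. *)
Lemma is_condexp_gain (N0 N1 : T -> 'cV[R]_m) :
  measurable_wrt G N0 -> Linfmv P N0 -> Linfmv P N1 ->
  {ae P, forall w, condexpv P G N1 w = N0 w} ->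
  is_condexp P G (fun w => dotv (r w) (N1 w - N0 w)) (fun=> 0).
Proof.
move=> mN0 LN0 LN1 N1E.
have L0 : Linfm P (fun w => dotv (r w) (N0 w)).
  by apply: Linfm_dotv => k; exact: Linfmv_coord.
have L1 : Linfm P (fun w => dotv (r w) (N1 w)).
  by apply: Linfm_dotv => k; exact: Linfmv_coord.
have c1 := is_condexp_dotv (fun k => Linfmv_coord k LN1).
have c0 : is_condexp P G (fun w => dotv (r w) (N0 w)) (fun w => dotv (r w) (N0 w)).
  by apply: is_condexp_self; [exact: measurable_wrt_dotv|exact: Linfm_integrable].
have := is_condexpD sG GT (Linfm_integrable L1) (integrableN (Linfm_integrable L0))
  c1 (is_condexpN sG GT (Linfm_integrable L0) c0).
have -> : (fun w => dotv (r w) (N1 w)) \+ (\- (fun w => dotv (r w) (N0 w))) =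
  fun w => dotv (r w) (N1 w - N0 w) by apply/funext => w /=; rewrite dotvBr.
move=> c; apply: (is_condexp_version GT c); first exact: measurable_wrt_cst.
by apply: filterS N1E => w /= ->; rewrite subrr.
Qed.

End OnePeriod.

(** * Sign of the weights *)

(** On the event that the weight rho is negative, the direction Z = - n rho^-
    is nonpositive, so monotonicity keeps F (Z b) below F 0; the Fenchel
    inequality gives F (Z b) >= n rho^2 minus the conjugate. Letting n grow is
    contradictory. Scaling by rho^- instead of an indicator keeps Z in every
    L^p by domination. *)
Lemma monotone_weight_ge0 {d} {T : measurableType d} {R : realType} {m : nat}
    (P : probability T R) (F : T -> 'cV[R]_m -> R) (r b : T -> 'cV[R]_m) :
  Linfm P (fun w => dotv (r w) (b w)) ->
  {ae P, forall w, conjugate (F w) (r w) \is a fin_num} ->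
  (forall Z : T -> R, Linfm P Z -> (forall w, Z w <= 0) ->
     {ae P, forall w, F w (Z w *: b w) <= F w 0}) ->
  {ae P, forall w, 0 <= dotv (r w) (b w)}.
Proof.
move=> Lrho cfin mono.
pose neg w := Num.max (- dotv (r w) (b w)) 0.
have neg0 w : 0 <= neg w by rewrite /neg le_max lexx orbT.
have Lneg : Linfm P neg.
  apply: (Linfm_dominated _ Lrho).
    apply: measurable_maxr => //; apply: measurable_funN.
    exact: (Linfm_measurable Lrho).
  move=> w; rewrite ger0_norm// /neg ge_max normr_ge0 andbT.
  by rewrite -normrN ler_norm.
have all_n : {ae P, forall w, forall n : nat, F w (- (n%:R * neg w) *: b w) <= F w 0}.
  apply: ae_foralln => n; apply: mono; last first.
    by move=> w; rewrite oppr_le0 mulr_ge0.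
  by apply: (LinfmN (LinfmM (Linfm_cst P n%:R) Lneg)).
apply: filterS2 all_n cfin => w Fle cf; rewrite leNgt; apply/negP => rho0.
pose rho := dotv (r w) (b w).
have negE : neg w = - rho by rewrite /neg max_l// oppr_ge0 ltW.
pose C := fine (conjugate (F w) (r w)) + F w 0.
have bound n : n%:R * rho ^+ 2 <= C.
  have := le_fine_conjugate (- (n%:R * neg w) *: b w) cf.
  rewrite dotvZr -/rho negE => h; have := Fle n; rewrite negE => h2.
  have -> : n%:R * rho ^+ 2 = - (n%:R * - rho) * rho by ring.
  by rewrite /C -lerBlDr (le_trans _ h)// lerB.
have rho2 : 0 < rho ^+ 2 by rewrite exprn_even_gt0//= lt_eqF.
have := bound (Num.truncn (C / rho ^+ 2)).+1.
rewrite -ler_pdivlMr// leNgt => /negP; apply.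
exact: truncnS_gt.
Qed.

(** * The backward recursion for theta *)

Lemma backward_induction (J : nat) (Q : nat -> Prop) :
  Q J -> (forall i, (i < J)%N -> Q i.+1 -> Q i) -> forall i, (i <= J)%N -> Q i.
Proof.
move=> QJ QS i iJ; rewrite -(subKn iJ).
elim: (J - i)%N => [|k IH]; first by rewrite subn0.
have [kJ|Jk] := ltnP k J.
  apply: QS; first by rewrite ltn_subrL /= (leq_ltn_trans _ kJ).
  by rewrite subnSK.
by move: IH; rewrite (eqP (Jk : (J - k == 0)%N)) (eqP (leqW Jk : (J - k.+1 == 0)%N)).
Qed.

Section LowerBound.
Context {d : measure_display} {T : measurableType d} {R : realType}.
Variables (P : probability T R) (J D : nat) (Fil : nat -> set (set T)).
Hypothesis hFil : complete_filtration P J Fil.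
Variables (F : nat -> T -> 'cV[R]_D -> R) (beta : nat -> T -> 'cV[R]_D).
Variable (xi : T -> R).
Hypothesis hF : convex_generator J Fil F.
Hypothesis hbeta : Linfmv_ad P J Fil beta.
Hypothesis hxi : Linfm P xi.
Variable (r : nat -> T -> 'cV[R]_D).
Hypothesis hr : admissible P J Fil F r.

Local Notation theta := (theta_low J F beta xi r).
Local Notation rho i := (fun w => dotv (r i w) (beta i.+1 w)).
Local Notation conj i := (fun w => fine (conjugate (F i w) (r i w))).

Lemma theta_low_end M : theta M J = xi.
Proof. by rewrite /theta_low subnn. Qed.

Lemma theta_low_step M i : (i < J)%N ->
  theta M i = fun w => rho i w * theta M i.+1 w
    - dotv (r i w) (M i.+1 w - M i w) - conj i w.
Proof.
by move=> iJ; apply/funext => w; rewrite /theta_low -(subnSK iJ) /= subnSK// subKn// ltnW.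
Qed.

Let sFil i : (i <= J)%N -> sigma_algebra setT (Fil i).
Proof. by case: hFil => + _ _ _; apply. Qed.

Let FilT i : (i <= J)%N -> Fil i `<=` measurable.
Proof. by case: hFil => _ + _ _; apply. Qed.

Let FilS i : (i < J)%N -> Fil i `<=` Fil i.+1.
Proof. by case: hFil => _ _ + _ iJ; apply; rewrite leqnSn. Qed.

Lemma Linfm_scaled (Z : nat -> T -> R) i k : (i <= J)%N -> Linfm P (Z i) ->
  Linfm P (fun w => scaled beta Z i w k 0).
Proof.
move=> iJ LZ; under eq_fun do rewrite /scaled mxE.
by apply: LinfmM => //; apply: Linfmv_coord; case: (hbeta iJ).
Qed.

Lemma Linfm_rho i : (i < J)%N -> Linfm P (rho i).
Proof.
move=> iJ; have [_ Lr _] := hr iJ; have [_ Lb] := hbeta iJ.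
by apply: Linfm_dotv => k; exact: Linfmv_coord.
Qed.

Lemma measurable_wrt_rho i : (i < J)%N -> measurable_wrt (Fil i.+1) (rho i).
Proof.
move=> iJ; have [mr _ _] := hr iJ; have [mb _] := hbeta iJ.
apply: measurable_wrt_dotv => //; first exact: sFil.
by move=> B mB; apply: FilS => //; exact: mr.
Qed.

Lemma is_condexp_rho (Z : nat -> T -> R) i : (i < J)%N -> Linfm P (Z i.+1) ->
  is_condexp P (Fil i) (fun w => rho i w * Z i.+1 w)
    (fun w => dotv (r i w) (cond_next P Fil beta Z i w)).
Proof.
move=> iJ LZ; have [mr Lr _] := hr iJ.
have -> : (fun w => rho i w * Z i.+1 w) = fun w => dotv (r i w) (scaled beta Z i.+1 w).
  by apply/funext => w; rewrite /scaled dotvZr mulrC.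
apply: is_condexp_dotv => //; [exact/sFil/ltnW|exact/FilT/ltnW|].
by move=> k; exact: Linfm_scaled.
Qed.

Variable M : nat -> T -> 'cV[R]_D.
Hypothesis hM : martingale P J Fil M.

Let Linfm_gain i : (i < J)%N -> Linfm P (fun w => dotv (r i w) (M i.+1 w - M i w)).
Proof.
move=> iJ; have [_ Lr _] := hr iJ; have [LM _] := hM.
apply: Linfm_dotv => k; first exact: Linfmv_coord.
under eq_fun do rewrite mxE [X in _ + X]mxE.
apply: LinfmB; apply: Linfmv_coord; [exact: (LM _ iJ).2|exact: (LM _ (ltnW iJ)).2].
Qed.

Lemma Linfm_theta i : (i <= J)%N -> Linfm P (theta M i).
Proof.
move: i; apply: backward_induction; first by rewrite theta_low_end.
move=> i iJ Lth; rewrite theta_low_step//; have [_ _ Lc] := hr iJ.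
apply: LinfmB; last exact: Linfm_fine.
apply: LinfmB; last exact: Linfm_gain.
by apply: LinfmM => //; exact: Linfm_rho.
Qed.

Local Notation W i := (condexp P (Fil i) (theta M i)).

Lemma condexp_theta i : (i <= J)%N -> is_condexp P (Fil i) (theta M i) (W i).
Proof.
by move=> iJ; apply: condexpP; [exact: sFil|exact: FilT|exact/Linfm_integrable/Linfm_theta].
Qed.

(** The function U is a version of E_i[rho_i W_(i+1)]. Conditioning
    rho_i theta_(i+1) first on F_(i+1) replaces theta_(i+1) by W_(i+1), and the
    pull-out rule supplies the integrability of rho_i W_(i+1) with which the
    monotonicity of conditional expectation is applied afterwards. *)
Lemma condexp_theta_step i : (i < J)%N ->
  P.-integrable setT (EFin \o (fun w => rho i w * W i.+1 w)) /\
  exists2 U, is_condexp P (Fil i) (fun w => rho i w * W i.+1 w) U &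
    {ae P, forall w, W i w = U w - conj i w}.
Proof.
move=> iJ; have iJ' := ltnW iJ.
have sG := sFil iJ'; have GT := FilT iJ'.
have [mr Lr Lc] := hr iJ; have [mF Fz cF] := hF iJ; have [LM MM] := hM.
have Lth := Linfm_theta iJ; have Lrho := Linfm_rho iJ.
have Lprod : Linfm P (fun w => rho i w * theta M i.+1 w) by exact: LinfmM.
have cH : is_condexp P (Fil i.+1) (fun w => rho i w * theta M i.+1 w)
                                 (fun w => rho i w * W i.+1 w).
  apply: (is_condexpM (sFil iJ) (FilT iJ)).
  - exact: measurable_wrt_rho.
  - exact: Linfm_integrable.
  - exact: (Linfm_integrable Lprod).
  - exact: condexp_theta.
split; first by case: cH.
have cU := condexpP sG GT (Linfm_integrable Lprod).
set U := condexp _ _ _ in cU.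
exists U; first exact: is_condexp_tower (FilS iJ) cH cU.
have Lgain := Linfm_gain iJ.
have cgain : is_condexp P (Fil i) (fun w => dotv (r i w) (M i.+1 w - M i w)) (fun=> 0).
  apply: is_condexp_gain => //; [exact: (LM _ iJ').1|exact: (LM _ iJ').2|exact: (LM _ iJ).2|].
  by apply: MM; rewrite leqnSn.
have Lconj : Linfm P (conj i) := Linfm_fine Lc.
have cconj : is_condexp P (Fil i) (conj i) (conj i).
  apply: is_condexp_self; last exact: Linfm_integrable.
  exact: measurable_wrt_conjugate.
have cB (X X' Z Z' : T -> R) : Linfm P X -> Linfm P X' ->
    is_condexp P (Fil i) X Z -> is_condexp P (Fil i) X' Z' ->
    is_condexp P (Fil i) (X \- X') (Z \- Z').
  move=> LX LX' cX cX'.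
  apply: (is_condexpD sG GT (Linfm_integrable LX)) => //.
    exact/Linfm_integrable/LinfmN.
  by apply: is_condexpN => //; exact: Linfm_integrable.
have := cB _ _ _ _ (LinfmB Lprod Lgain) Lconj (cB _ _ _ _ Lprod Lgain cU cgain) cconj.
(* Versions of the three summands of the recursion for theta_i add up. *)
rewrite -[X in is_condexp _ _ X _](theta_low_step M iJ) => cth.
have ith := Linfm_integrable (Linfm_theta iJ').
apply: filterS (is_condexp_ae_eq sG GT ith (condexp_theta iJ') cth) => w ->.
by rewrite /= subr0.
Qed.

(** One step of the upper comparison: a nonnegative weight transports
    W_(i+1) <= Z_(i+1) through the recursion. *)
Lemma condexp_theta_le (Z : nat -> T -> R) i : (i < J)%N -> Linfm P (Z i.+1) ->
  {ae P, forall w, 0 <= rho i w} -> {ae P, forall w, W i.+1 w <= Z i.+1 w} ->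
  {ae P, forall w,
    W i w <= dotv (r i w) (cond_next P Fil beta Z i w) - conj i w}.
Proof.
move=> iJ LZ rho0 WZ; have [irW [U cU WE]] := condexp_theta_step iJ.
have irZ : P.-integrable setT (EFin \o (fun w => rho i w * Z i.+1 w)).
  exact/Linfm_integrable/(LinfmM (Linfm_rho iJ) LZ).
have rWZ : {ae P, forall w, rho i w * W i.+1 w <= rho i w * Z i.+1 w}.
  by apply: filterS2 rho0 WZ => w r0 le; rewrite ler_wpM2l.
have := is_condexp_le (sFil (ltnW iJ)) (FilT (ltnW iJ)) irW irZ cU
  (is_condexp_rho iJ LZ) rWZ.
by apply: filterS2 WE => w -> le; rewrite lerB.
Qed.

Lemma condexp_theta_ge (Z : nat -> T -> R) i : (i < J)%N -> Linfm P (Z i.+1) ->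
  {ae P, forall w, 0 <= rho i w} -> {ae P, forall w, Z i.+1 w <= W i.+1 w} ->
  {ae P, forall w,
    dotv (r i w) (cond_next P Fil beta Z i w) - conj i w <= W i w}.
Proof.
move=> iJ LZ rho0 WZ; have [irW [U cU WE]] := condexp_theta_step iJ.
have irZ : P.-integrable setT (EFin \o (fun w => rho i w * Z i.+1 w)).
  exact/Linfm_integrable/(LinfmM (Linfm_rho iJ) LZ).
have rWZ : {ae P, forall w, rho i w * Z i.+1 w <= rho i w * W i.+1 w}.
  by apply: filterS2 rho0 WZ => w r0 le; rewrite ler_wpM2l.
have := is_condexp_le (sFil (ltnW iJ)) (FilT (ltnW iJ)) irZ irW
  (is_condexp_rho iJ LZ) cU rWZ.
by apply: filterS2 WE => w -> le; rewrite lerB.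
Qed.

End LowerBound.

(** * Two-sided bounds and pathwise tightness *)

Unset Implicit Arguments.
Set Strict Implicit.

Theorem theorem3p1
  (d : measure_display) (T : measurableType d) (R : realType)
  (P : probability T R) (J D : nat) (Fil : nat -> set (set T))
  (hFil : complete_filtration P J Fil)
  (F : nat -> T -> 'cV[R]_D -> R)
  (beta : nat -> T -> 'cV[R]_D) (xi : T -> R)
  (hF : convex_generator J Fil F)
  (hgrowth : polynomial_growth P J Fil F)
  (hbeta : Linfmv_ad P J Fil beta)
  (hxi_meas : measurable_wrt (Fil J) xi) (hxi : Linfm P xi)
  (hmono : monotone_generator P J F beta)
  (Y : nat -> T -> R) (hY : dp_solution P J Fil F beta xi Y)
  (j : nat) (hj : (j < J)%N)
  (Ybar : nat -> T -> R) (hYbar : dp_subsolution P J Fil F beta Y Ybar)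
  (rbar : nat -> T -> 'cV[R]_D) (hrbar : admissible P J Fil F rbar)
  (hopt : forall i, (i < J)%N -> {ae P, forall w,
     ((dotv (rbar i w) (cond_next P Fil beta Ybar i w))%:E
        - conjugate (F i w) (rbar i w)
      = (F i w (cond_next P Fil beta Ybar i w))%:E)%E})
  (M : nat -> T -> 'cV[R]_D) (hM : martingale P J Fil M) :
  (forall i, (i < J)%N -> {ae P, forall w,
     [/\ Y i w >= condexp P (Fil i) (theta_low J F beta xi rbar M i) w,
         condexp P (Fil i) (theta_low J F beta xi rbar M i) w
           >= F i w (cond_next P Fil beta Ybar i w) &
         F i w (cond_next P Fil beta Ybar i w) >= Ybar i w]})
  /\
  ((forall i, (j < i <= J)%N -> {ae P, forall w, Ybar i w = Y i w}) ->
   {ae P, forall w,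
     condexp P (Fil j) (theta_low J F beta xi rbar M j) w
       = theta_low J F beta xi rbar (doob P Fil (scaled beta Ybar)) j w
     /\ theta_low J F beta xi rbar (doob P Fil (scaled beta Ybar)) j w
       = Y j w}).
Proof.
have [sFil FilT FilS _] := hFil.
have [LY YJ YE] := hY; have [LYb YbJ YbE] := hYbar.
have cfin i : (i < J)%N ->
    {ae P, forall w, conjugate (F i w) (rbar i w) \is a fin_num}.
  by move=> iJ; apply: filterS (hopt i iJ) => w; case: conjugate.
have opt i : (i < J)%N -> {ae P, forall w,
    dotv (rbar i w) (cond_next P Fil beta Ybar i w)
      - fine (conjugate (F i w) (rbar i w))
    = F i w (cond_next P Fil beta Ybar i w)}.
  move=> iJ; apply: filterS2 (cfin i iJ) (hopt i iJ) => w cf.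
  by rewrite -{1}(fineK cf) -EFinB => -[].
have rho0 i : (i < J)%N -> {ae P, forall w, 0 <= dotv (rbar i w) (beta i.+1 w)}.
  move=> iJ; apply: (@monotone_weight_ge0 _ _ _ _ P (F i)) => //.
  - exact: (Linfm_rho hbeta hrbar iJ).
  - exact: cfin.
  - move=> Z LZ Z0.
    have := hmono (fun=> 0) Z (Linfm_cst P 0) LZ (aeW _ Z0) i iJ.
    by apply: filterS => w; rewrite scale0r.
set th := theta_low J F beta xi rbar.
pose W i := condexp P (Fil i) (th M i).
have upper i : (i <= J)%N -> {ae P, forall w, Ybar i w <= W i w <= Y i w}.
  move: i; apply: backward_induction.
    have cW : is_condexp P (Fil J) xi (W J).
      have := condexp_theta hFil hbeta hxi hrbar hM (leqnn J).
      by rewrite /W /th theta_low_end.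
    have ix := Linfm_integrable hxi.
    have := is_condexp_ae_eq (sFil J (leqnn J)) (FilT J (leqnn J)) ix
      cW (is_condexp_self hxi_meas ix).
    apply: filterS3 YJ YbJ => w YJw + ->.
    by rewrite YJw lexx andbT.
  move=> i iJ IH.
  have IHl : {ae P, forall w, Ybar i.+1 w <= W i.+1 w} by apply: filterS IH => w /andP[].
  have IHu : {ae P, forall w, W i.+1 w <= Y i.+1 w} by apply: filterS IH => w /andP[].
  have low := condexp_theta_ge hFil hF hbeta hxi hrbar hM iJ (LYb _ iJ).2 (rho0 _ iJ) IHl.
  have up := condexp_theta_le hFil hF hbeta hxi hrbar hM iJ (LY _ iJ).2 (rho0 _ iJ) IHu.
  have Yge : {ae P, forall w, dotv (rbar i w) (cond_next P Fil beta Y i w)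
      - fine (conjugate (F i w) (rbar i w)) <= Y i w}.
    apply: filterS2 (YE i iJ) (cfin i iJ) => w -> cf.
    have := le_fine_conjugate (cond_next P Fil beta Y i w) cf; lra.
  have lowF : {ae P, forall w, Ybar i w <= W i w}.
    apply: filterS3 low (opt i iJ) (YbE i iJ) => w lew eqw YbF.
    by rewrite (le_trans YbF)// -eqw.
  by apply: filterS3 up Yge lowF => w h1 h2 ->; rewrite (le_trans h1 h2).
have part1 i : (i < J)%N -> {ae P, forall w,
     [/\ Y i w >= W i w, W i w >= F i w (cond_next P Fil beta Ybar i w) &
         F i w (cond_next P Fil beta Ybar i w) >= Ybar i w]}.
  move=> iJ.
  have IHl : {ae P, forall w, Ybar i.+1 w <= W i.+1 w}.
    by apply: filterS (upper _ iJ) => w /andP[].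
  have low := condexp_theta_ge hFil hF hbeta hxi hrbar hM iJ (LYb _ iJ).2 (rho0 _ iJ) IHl.
  have lowF : {ae P, forall w, F i w (cond_next P Fil beta Ybar i w) <= W i w}.
    by apply: filterS2 low (opt i iJ) => w lew <-.
  apply: filterS3 (upper _ (ltnW iJ)) lowF (YbE i iJ) => w /andP[_ h1] h2 h3.
  by split.
split=> // YbY.
have next i : (j <= i < J)%N -> {ae P, forall w,
    F i w (cond_next P Fil beta Ybar i w) = Y i w}.
  move=> /andP[ji iJ].
  (* Almost surely equal integrands have the same chosen version. *)
  have -> : cond_next P Fil beta Ybar i = cond_next P Fil beta Y i.
    apply/funext => w; apply/colP => k; rewrite !mxE.
    congr (_ w); apply: condexp_ae_eq.
    - exact: FilT _ (ltnW iJ).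
    - exact: Linfm_measurable (Linfm_scaled hbeta k iJ (LYb _ iJ).2).
    - exact: Linfm_measurable (Linfm_scaled hbeta k iJ (LY _ iJ).2).
    - have := YbY i.+1; rewrite ltnS ji iJ => /(_ isT).
      by apply: filterS => w' /= E; rewrite /scaled E.
  by apply: filterS (YE i iJ) => w ->.
have path i : (i <= J)%N -> (j <= i)%N ->
    {ae P, forall w, th (doob P Fil (scaled beta Ybar)) i w = Y i w}.
  move: i; apply: backward_induction.
    by move=> _; apply: filterS YJ => w ->; rewrite /th theta_low_end.
  move=> i iJ IH ji.
  have := IH (leqW ji); have := opt i iJ.
  have := YbY i.+1; rewrite ltnS ji iJ => /(_ isT).
  have := next i; rewrite ji iJ => /(_ isT).
  move=> hnext hYb hopt_i hth.
  apply: filterS3 hnext hopt_i (filterI hYb hth) => w nextw optw [Ybw thw].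
  (* The Doob increment cancels the fluctuation of beta Ybar around its conditional mean. *)
  have doobB : doob P Fil (scaled beta Ybar) i.+1 w - doob P Fil (scaled beta Ybar) i w
      = scaled beta Ybar i.+1 w - cond_next P Fil beta Ybar i w.
    by rewrite /doob big_nat_recr//= [LHS]addrC addKr.
  rewrite /th theta_low_step// -/th thw doobB dotvBr /scaled dotvZr Ybw.
  rewrite -nextw -optw; ring.
apply: filterS3 (part1 j hj) (next j _) (path j (ltnW hj) (leqnn j)); last first.
  by rewrite leqnn.
move=> w [leY geF _] nextw pathw; split=> //.
rewrite [RHS]pathw; apply/eqP; rewrite eq_le leY /= -[leLHS]nextw.
exact: geF.
Qed.
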